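(* Let $G$ be a group with neutral element $e$, and let $A=\bigoplus_{g\in G}A_g$ be a finite dimensional $G$-graded algebra over a field $k$ such that $A$ is a Frobenius algebra and $A_e$ is a local ring. Then there exists $\sigma\in G$ such that $A$ is $\sigma$-graded Frobenius.
   Context: A finite dimensional $k$-algebra $R$ is Frobenius if $R\simeq R^*$ as left $R$-modules, where $R^*=\mathrm{Hom}_k(R,k)$ with $(af)(x)=f(xa)$. $A-gr$ denotes the category of $G$-graded left $A$-modules (with degree-preserving $A$-linear maps). For $M\in A-gr$ and $\sigma\in G$, the suspension $M(\sigma)$ is $M$ as an $A$-module with grading $M(\sigma)_g=M_{g\sigma}$. The dual space $A^*$ is a graded left $A$-module with $(af)(x)=f(xa)$ and grading $(A^* )_g=\{f\in A^* \mid f(A_h)=0 \text{ for any } h\neq g^{-1}\}$. $A$ is called $\sigma$-graded Frobenius if $A(\sigma)\simeq A^*$ in $A-gr$. *)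

(* Defs.v *)
From HB Require Import structures.
From mathcomp Require Import all_boot all_order all_fingroup all_algebra all_field.

Set Implicit Arguments.
Unset Strict Implicit.
Unset Printing Implicit Defensive.

Import GRing.Theory.
Local Open Scope ring_scope.

Record left_ideal (R : nzRingType) (I : R -> Prop) : Prop := LeftIdeal {
  left_ideal0 : I 0;
  left_idealD : forall x y, I x -> I y -> I (x + y);
  left_idealM : forall a x, I x -> I (a * x) }.

Definition maximal_left_ideal (R : nzRingType) (I : R -> Prop) : Prop :=
  [/\ left_ideal I, ~ I 1
    & forall J : R -> Prop, left_ideal J -> ~ J 1 ->
        (forall x, I x -> J x) -> forall x, J x -> I x].

(* R is not assumed to be commutative. *)
Definition local_ring (R : nzRingType) : Prop :=
  (exists I : R -> Prop, maximal_left_ideal I) /\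
  (forall I J : R -> Prop, maximal_left_ideal I -> maximal_left_ideal J ->
     forall x, I x <-> J x).

(* V is the internal direct sum of the C i; the index type I may be infinite,
   and each C i is meant to be an additive subgroup of V. *)
Definition direct_sum (V : zmodType) (I : eqType) (C : I -> V -> Prop) : Prop :=
  (forall v, exists (s : seq I) (d : I -> V),
     [/\ uniq s, forall i, C i (d i) & v = \sum_(i <- s) d i]) /\
  (forall (s : seq I) (d : I -> V), uniq s -> (forall i, C i (d i)) ->
     \sum_(i <- s) d i = 0 -> forall i, i \in s -> d i = 0).

Lemma direct_sum_homog (V : zmodType) (I : eqType) (C : I -> V -> Prop) s d h :
  direct_sum C -> (forall i, C i 0) ->
  (forall i x y, C i x -> C i y -> C i (x - y)) ->
  uniq s -> (forall i, C i (d i)) -> C h (\sum_(i <- s) d i) ->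
  \sum_(i <- s) d i = if h \in s then d h else 0.
Proof.
move=> [_ indep] C0 CB us Cd; set v := \sum_(i <- s) d i => Cv.
case: ifPn => hs.
  have := indep s (fun i => d i - (if i == h then v else 0)) us.
  have Cc i : C i (d i - (if i == h then v else 0)).
    by apply: CB => //; case: eqP => [->|_].
  move=> /(_ Cc); rewrite sumrB -/v (bigD1_seq h) //= eqxx.
  rewrite big1; last by move=> i ih; rewrite (negPf ih).
  rewrite addr0 subrr => /(_ erefl h hs).
  by rewrite eqxx => /eqP; rewrite subr_eq0 => /eqP.
have := indep (h :: s) (fun i => if i == h then 0 - v else d i).
rewrite /= hs us => /(_ isT) H.
have /H{H} : forall i, C i (if i == h then 0 - v else d i).
  by move=> i; case: eqP => [->|_] //; exact: CB.
rewrite big_cons eqxx big_seq (eq_bigr d) => [|i si]; last first.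
  by case: eqP => // ih; rewrite -ih si in hs.
rewrite -big_seq -/v sub0r addNr => /(_ erefl h (mem_head _ _)).
by rewrite eqxx => /eqP; rewrite oppr_eq0 => /eqP.
Qed.

Record grading (G : groupType) (k : fieldType) (A : falgType k) := Grading {
  homog :> G -> {vspace A};
  homog_direct : direct_sum (fun g x => x \in homog g);
  homogM : forall g h x y,
    x \in homog g -> y \in homog h -> x * y \in homog (g * h)%g }.

Section IdentityComponent.

Variables (G : groupType) (k : fieldType) (A : falgType k) (gr : grading G A).

Lemma homog1 : 1 \in gr 1%g.
Proof.
have [span _] := homog_direct gr; have [s [d [us hd e1]]] := span 1.
pose d1 := if 1%g \in s then d 1%g else 0.
have hd1 : d1 \in gr 1%g by rewrite /d1; case: ifP => // _; rewrite mem0v.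
have d1h h x : x \in gr h -> d1 * x = x.
  move=> hx; pose t := [seq (g * h)%g | g <- s].
  have sumE : \sum_(i <- t) d (i * h^-1)%g * x = x.
    rewrite big_map (eq_bigr (fun g => d g * x)); last by move=> g _; rewrite mulgK.
    by rewrite -mulr_suml -e1 mul1r.
  rewrite -[RHS]sumE (direct_sum_homog (homog_direct gr) (h := h)) ?sumE //.
  - have -> : (h \in t) = (1%g \in s).
      by rewrite -{1}[h]mul1g (mem_map (mulIg h)).
    by rewrite mulgV /d1; case: ifP; rewrite ?mul0r.
  - by move=> i; rewrite mem0v.
  - by move=> i u v; exact: memvB.
  - by rewrite map_inj_uniq //; exact: mulIg.
  by move=> i; have := homogM (hd (i * h^-1)%g) hx; rewrite mulgVK.
suff -> : 1 = d1 by [].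
rewrite -[RHS]mulr1 {2}e1 mulr_sumr [LHS]e1.
by apply: eq_bigr => g _; rewrite (d1h g).
Qed.

Fact homog1_is_aspace : is_aspace (gr 1%g).
Proof.
rewrite /is_aspace has_algid1 ?homog1 //=; apply/prodvP => x y hx hy.
by have := homogM hx hy; rewrite mulg1.
Qed.

(* The unit of an {aspace A} may differ from 1 in general; here it is 1, by homog1. *)
Definition identity_component : {aspace A} := ASpace homog1_is_aspace.

End IdentityComponent.

(* The k-linear dual, with its left R-module structure (a f)(x) = f (x a). *)
Section Dual.

Variables (k : fieldType) (R : falgType k).

Definition dual : Type := 'Hom(R, k^o).
HB.instance Definition _ := GRing.Zmodule.on dual.

Definition dual_scale (a : R) (f : dual) : dual := (f \o amulr a)%VF.

Lemma dual_scaleE a f x : (dual_scale a f : 'Hom(R, k^o)) x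
  = (f : 'Hom(R, k^o)) (x * a).
Proof. by rewrite comp_lfunE lfunE. Qed.

Fact dual_scaleA a b f :
  dual_scale a (dual_scale b f) = dual_scale (a * b) f.
Proof. by apply/lfunP => x; rewrite !dual_scaleE mulrA. Qed.

Fact dual_scale1 : left_id 1 dual_scale.
Proof. by move=> f; apply/lfunP => x; rewrite !dual_scaleE mulr1. Qed.

Fact dual_scaleDr : right_distributive dual_scale +%R.
Proof.
by move=> a f g; apply/lfunP => x; rewrite add_lfunE !dual_scaleE add_lfunE.
Qed.

Fact dual_scaleDl f : {morph dual_scale^~ f : a b / a + b}.
Proof.
by move=> a b; apply/lfunP => x; rewrite add_lfunE !dual_scaleE mulrDr linearD.
Qed.

HB.instance Definition _ := GRing.Zmodule_isLmodule.Build R dual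
  dual_scaleA dual_scale1 dual_scaleDr dual_scaleDl.

End Dual.

(* R^o is R as a left module over itself. *)
Definition frobenius (k : fieldType) (R : falgType k) : Prop :=
  exists f : {linear R^o -> dual R}, bijective f.

(* Objects of A-gr; gcomp g is the homogeneous component of degree g. *)
Record gradedModule (G : groupType) (k : fieldType) (A : falgType k)
    (gr : grading G A) := GradedModule {
  gmod :> lmodType A;
  gcomp : G -> gmod -> Prop;
  gcomp0 : forall g, gcomp g 0;
  gcompB : forall g x y, gcomp g x -> gcomp g y -> gcomp g (x - y);
  gcomp_direct : direct_sum gcomp;
  gcompZ : forall g h a x,
    a \in gr g -> gcomp h x -> gcomp (g * h)%g (a *: x) }.

Section GradedModules.

Variables (G : groupType) (k : fieldType) (A : falgType k) (gr : grading G A).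

Definition graded_hom (M N : gradedModule gr) (f : {linear M -> N}) : Prop :=
  forall g x, gcomp g x -> gcomp g (f x).

Definition graded_iso (M N : gradedModule gr) : Prop :=
  exists (f : {linear M -> N}) (f' : {linear N -> M}),
    [/\ graded_hom f, graded_hom f', cancel f f' & cancel f' f].

Section Suspension.

Variables (M : gradedModule gr) (sigma : G).

Definition suspension_comp (g : G) (x : M) : Prop := gcomp (g * sigma)%g x.

Fact suspension_comp_direct : direct_sum suspension_comp.
Proof.
have [span indep] := gcomp_direct M; split=> [v | s d us hd d0 g gs].
  have [s [d [us hd ->]]] := span v.
  exists [seq (g * sigma^-1)%g | g <- s], (fun g => d (g * sigma)%g).
  split=> [||]; first by rewrite map_inj_uniq //; exact: mulIg.
    by move=> i; exact: hd.
  by rewrite big_map; apply: eq_bigr => i _; rewrite mulgVK.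
have := indep [seq (g * sigma)%g | g <- s] (fun g => d (g * sigma^-1)%g).
rewrite map_inj_uniq; last exact: mulIg.
move=> /(_ us) H.
have /H{H} : forall i, gcomp i (d (i * sigma^-1)%g).
  by move=> i; have := hd (i * sigma^-1)%g; rewrite /suspension_comp mulgVK.
rewrite big_map (eq_bigr d); last by move=> i _; rewrite mulgK.
by move=> /(_ d0 (g * sigma)%g (map_f _ gs)); rewrite mulgK.
Qed.

Fact suspension_compZ g h a (x : M) :
  a \in gr g -> suspension_comp h x -> suspension_comp (g * h)%g (a *: x).
Proof. by move=> ga hx; rewrite /suspension_comp -mulgA; exact: gcompZ. Qed.

Definition suspension : gradedModule gr :=
  @GradedModule _ _ _ gr M suspension_comp
    (fun g => gcomp0 M (g * sigma)%g)
    (fun g x y => @gcompB _ _ _ _ M (g * sigma)%g x y)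
    suspension_comp_direct suspension_compZ.

End Suspension.

Definition regular_comp (g : G) (x : A^o) : Prop := (x : A) \in gr g.

Definition graded_regular : gradedModule gr :=
  @GradedModule _ _ _ gr A^o regular_comp
    (fun g => mem0v (gr g)) (fun g x y => @memvB _ _ (gr g) x y)
    (homog_direct gr) (@homogM _ _ _ gr).

Definition dual_comp (g : G) (f : dual A) : Prop :=
  forall h : G, h != g^-1%g ->
  forall x : A, x \in gr h -> (f : 'Hom(A, k^o)) x = 0.

Fact dual_comp0 g : dual_comp g 0.
Proof. by move=> h _ x _; rewrite zero_lfunE. Qed.

Fact dual_compB g f f' : dual_comp g f -> dual_comp g f' -> dual_comp g (f - f').
Proof.
move=> hf hf' h hg x hx.
by rewrite add_lfunE opp_lfunE (hf h hg x hx) (hf' h hg x hx) subr0.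
Qed.

Fact dual_compZ g h a (f : dual A) :
  a \in gr g -> dual_comp h f -> dual_comp (g * h)%g (a *: f).
Proof.
move=> ga hf i ih x xi; rewrite [LHS]dual_scaleE.
apply: (hf (i * g)%g); last exact: homogM.
by apply: contraNneq ih => ig; rewrite invMg -ig mulgK.
Qed.

Lemma homog_support : exists s : seq G,
  uniq s /\ {:A}%VS = (\sum_(g <- s) gr g)%VS.
Proof.
have [span _] := homog_direct gr.
have memS (s : seq G) g : g \in s -> (gr g <= \sum_(i <- s) gr i)%VS.
  by move=> gs; rewrite (big_rem g) //= addvSl.
have [s hs] : exists s : seq G,
    forall x, x \in (vbasis {:A} : seq A) -> x \in (\sum_(g <- s) gr g)%VS.
  elim: (vbasis {:A} : seq A) => [|x X [s hs]]; first by exists [::].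
  have [r [d [_ hd xE]]] := span x; exists (r ++ s) => y.
  rewrite big_cat inE => /predU1P[->|/hs ys]; last first.
    exact: (subvP (addvSr _ _)).
  apply: (subvP (addvSl _ _)); rewrite xE big_seq; apply: memv_suml => g gs.
  exact: (subvP (memS _ _ gs)).
exists (undup s); split; first exact: undup_uniq.
apply/eqP; rewrite eqEsubv subvf andbT -(span_basis (vbasisP fullv)).
apply/span_subvP => x /hs; apply/subvP; rewrite big_seq.
elim/big_rec: _ => [|g U gs sU]; first exact: sub0v.
by rewrite subv_add sU andbT memS ?mem_undup.
Qed.

Fact dual_comp_direct : direct_sum dual_comp.
Proof.
have [span indep] := homog_direct gr; split=> [f | s d us hd d0 g gs].
  have [s [us sE]] := homog_support.
  pose P g : 'End(A) := sumv_pi_for sE g.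
  have sumP x : \sum_(g <- s) P g x = x.
    by apply: sumv_pi_uniq_sum; rewrite ?memvf ?filter_uniq.
  have P0 g h x : g \in s -> x \in gr h -> g != h -> P g x = 0.
    move=> gs hx gh.
    have hP i : P i x \in gr i by exact: memv_sum_pi.
    have := direct_sum_homog (homog_direct gr) (h := h) (fun i => mem0v (gr i))
      (fun i u v => @memvB _ _ (gr i) u v) us hP.
    rewrite sumP => /(_ hx) xE.
    have := indep s (fun i => P i x - (if i == h then x else 0)) us.
    have hc i : P i x - (if i == h then x else 0) \in gr i.
      by apply: memvB => //; case: eqP => [->|_]; rewrite ?mem0v.
    move=> /(_ hc) H; have {H} := H _ g gs; rewrite (negPf gh) subr0; apply.
    rewrite sumrB sumP; apply/eqP; rewrite subr_eq0 eq_sym; apply/eqP.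
    case: ifPn xE => hs xE.
      by rewrite (bigD1_seq h) //= eqxx big1 ?addr0 // => i /negPf ->.
    by rewrite xE big1 // => i _; case: ifP.
  exists [seq g^-1%g | g <- s],
    (fun g => if g^-1%g \in s then (f \o P g^-1%g)%VF else 0).
  split; first by rewrite map_inj_uniq //; exact: invg_inj.
    move=> g; case: ifP => gs; last exact: dual_comp0.
    by move=> h hg x hx; rewrite comp_lfunE (P0 _ h) ?linear0 // eq_sym.
  rewrite big_map big_seq; apply/lfunP => x; rewrite sum_lfunE.
  rewrite -{1}[x]sumP linear_sum big_seq; apply: eq_bigr => g gs.
  by rewrite invgK gs comp_lfunE.
apply/lfunP => x; rewrite zero_lfunE.
have [r [c [_ hc ->]]] := span x; rewrite linear_sum big1 // => h _.
have [hg|hg] := eqVneq h g^-1%g; last exact: (hd g h hg _ (hc h)).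
have : (\sum_(i <- s) d i : 'Hom(A, k^o)) (c h) = 0 by rewrite d0 zero_lfunE.
rewrite sum_lfunE (bigD1_seq g) //= big1 ?addr0 // => i ig.
by apply: (hd i h) => //; rewrite hg (inj_eq invg_inj) eq_sym.
Qed.

Definition graded_dual : gradedModule gr :=
  @GradedModule _ _ _ gr (dual A) dual_comp
    dual_comp0 dual_compB dual_comp_direct dual_compZ.

Definition graded_frobenius (sigma : G) : Prop :=
  graded_iso (suspension graded_regular sigma) graded_dual.

End GradedModules.

(* Main.v *)
Require Import Defs.
From mathcomp Require Import all_boot all_order all_fingroup all_algebra all_field.
From HB Require Import structures.
From Stdlib Require Import Classical.

Set Implicit Arguments.
Unset Strict Implicit.
Unset Printing Implicit Defensive.

Import GRing.Theory.
Local Open Scope ring_scope.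

(** An isomorphism [f : A -> A^*] makes [A^*] free of rank one on
[lambda = f 1], but [lambda] need not be homogeneous. Locality of [A_e] shows
that some homogeneous component of [lambda] is a generator as well.

Let [lambda = \sum_g d g] with [d g] of degree [g], let [psi] be the inverse of
[f], and put [v g = psi (d g)], so that [\sum_g v g = psi lambda = 1]. Taking
components of degree [e] gives [\sum_g p (v g) = 1] in [A_e], where [p] is the
projection onto [A_e]. A sum of nonunits of a local ring is not [1]
([local_sum1_unit]), so [p (v tau)] is a unit of [A_e] for some [tau].

Then [v tau] itself is a unit of [A]. Indeed, let [a * v tau = 0]; applying [f]
gives [a *: d tau = 0]. Since [d tau] is homogeneous, each homogeneous component
[c] of [a] satisfies [c *: d tau = 0] ([homog_component_annihilator]), that is
[c * v tau = 0]. As [c] is homogeneous, the components of [v tau] can be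
separated, so [c * p (v tau) = 0] and [c = 0]. Thus right multiplication by
[v tau] is injective on the finite dimensional space [A], hence bijective.

Consequently [a |-> a *: d tau], which is [a |-> f (a * v tau)], is bijective.
It shifts degrees by [tau] on the right, so it is a graded isomorphism from
[A(sigma)] to [A^*] for [sigma = tau^-1]. *)

Section FiniteDimensionalAlgebra.

Variables (k : fieldType) (R : falgType k).

(** In finite dimension an injective right multiplication by [x] is surjective,
which provides a left inverse [y]; then [(x * y - 1) * x = 0] makes it two-sided. *)
Lemma unitr_rreg (x : R) : (forall a, a * x = 0 -> a = 0) -> x \is a GRing.unit.
Proof.
move=> x_reg; have inj0 : lker (amulr x) == 0%VS.
  apply/lker0P => a b; rewrite !lfunE /= => /eqP.
  by rewrite -subr_eq0 -mulrBl => /eqP /x_reg /eqP; rewrite subr_eq0 => /eqP.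
pose y := (amulr x)^-1%VF 1.
have yx : y * x = 1 by have := lker0_lfunVK inj0 1; rewrite lfunE.
apply/unitrP; exists y; split=> //; apply/eqP; rewrite -subr_eq0; apply/eqP.
by apply: x_reg; rewrite mulrBl -mulrA yx mulr1 mul1r subrr.
Qed.

Lemma unitr_left_invertible (a u : R) : a * u = 1 -> u \is a GRing.unit.
Proof.
move=> au; have Ua : a \is a GRing.unit.
  by apply: unitr_rreg => x xa; rewrite -[x]mulr1 -au mulrA xa mul0r.
by have -> : u = a^-1; rewrite ?unitrV // -[u](mulKr Ua) au mulr1.
Qed.

Lemma left_idealZ (J : R -> Prop) (c : k) x : left_ideal J -> J x -> J (c *: x).
Proof. by move=> idJ Jx; rewrite -[x]mul1r scalerAl; apply: left_idealM. Qed.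

Lemma left_ideal_sum (J : R -> Prop) (I : eqType) (s : seq I) (u : I -> R) :
  left_ideal J -> (forall i, i \in s -> J (u i)) -> J (\sum_(i <- s) u i).
Proof.
move=> idJ Ju; rewrite big_seq; elim/big_ind: _ => //.
  exact: left_ideal0.
exact: left_idealD.
Qed.

(** As long as [J] is not maximal it can be enlarged to a proper left ideal with
a new element. Ideals being mere predicates, they have no dimension; the process
is instead bounded by the dimension of a subspace [U] contained in the ideal,
which grows by the line through each new element. *)
Lemma exists_maximal_left_ideal (J : R -> Prop) :
  left_ideal J -> ~ J 1 ->
  exists2 M, maximal_left_ideal M & forall x, J x -> M x.
Proof.
have [n] := ubnP (\dim {:R} - \dim (0%VS : {vspace R})).
have : forall x, x \in (0%VS : {vspace R}) -> left_ideal J -> J x.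
  by move=> x /[!memv0] /eqP -> /left_ideal0.
elim: n J (0%VS : {vspace R}) => // n IHn J U UJ ltn idJ J1.
have [[K [idK K1 JK] [x Kx Jx]]|maxJ] := classic (exists2 K,
    [/\ left_ideal K, ~ K 1 & forall x, J x -> K x] & exists2 x, K x & ~ J x).
  have [|||//|M maxM KM] := IHn K (U + <[x]>)%VS.
  - move=> _ /memv_addP[y Uy [_ /vlineP[c ->] ->]] _.
    by apply: left_idealD => //; [apply/JK/UJ | apply: left_idealZ].
  - have ltU : (\dim U < \dim (U + <[x]>))%N.
      rewrite ltn_neqAle dimvS ?addvSl // andbT.
      apply: contra_notN Jx => /eqP dimE; apply: UJ => //.
      have /eqP -> : U == (U + <[x]>)%VS by rewrite eqEdim addvSl dimE leqnn.
      by rewrite memvE addvSr.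
    apply: leq_trans (ltn : _ <= n)%N; apply: ltn_sub2l => //.
    exact: leq_trans ltU (dimvS (subvf _)).
  - by [].
  by exists M => // y /JK /KM.
exists J => //; split=> // K idK K1 JK x Kx.
by apply: NNPP => Jx; case: maxJ; exists K => //; exists x.
Qed.

(** A nonunit [u] has no left inverse, so [R u] is a proper left ideal; a maximal
left ideal above it must be [M], the only one. *)
Lemma local_nonunit (M : R -> Prop) (u : R) :
  local_ring R -> maximal_left_ideal M -> u \isn't a GRing.unit -> M u.
Proof.
move=> [_ uniqM] maxM nUu.
have [|[a au]|N maxN JN] := @exists_maximal_left_ideal (fun x => exists a, x = a * u).
- split; first by exists 0; rewrite mul0r.
    by move=> _ _ [a ->] [b ->]; exists (a + b); rewrite mulrDl.
  by move=> b _ [a ->]; exists (b * a); rewrite mulrA.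
- by rewrite (unitr_left_invertible (esym au)) in nUu.
by apply/(uniqM _ _ maxM maxN)/JN; exists 1; rewrite mul1r.
Qed.

Lemma local_sum1_unit (I : eqType) (s : seq I) (u : I -> R) :
  local_ring R -> \sum_(i <- s) u i = 1 ->
  exists2 i, i \in s & u i \is a GRing.unit.
Proof.
move=> locR sum1; have [[M maxM] _] := locR; have [idM M1 _] := maxM.
have [/hasP //|/hasPn nU] := boolP (has (fun i => u i \is a GRing.unit) s).
case: M1; rewrite -sum1; apply: left_ideal_sum => // i /nU nUi.
exact: local_nonunit.
Qed.

End FiniteDimensionalAlgebra.

Section Graded.

Variables (G : groupType) (k : fieldType) (A : falgType k) (gr : grading G A).

Lemma algid_identity_component : algid (identity_component gr) = 1.
Proof. by apply/eqP; rewrite algid_eq1 homog1. Qed.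

Lemma homog_proj : exists (s : seq G) (p : G -> 'End(A)),
  [/\ uniq s, forall g x, p g x \in gr g & forall x, x = \sum_(g <- s) p g x].
Proof.
have [s [us sE]] := homog_support gr.
exists s, (sumv_pi_for sE); split=> // [g x|x]; first exact: memv_sum_pi.
by rewrite sumv_pi_uniq_sum ?memvf ?filter_uniq.
Qed.

(** The projection onto [A_e]. The last clause holds because left multiplication
by a homogeneous [a] sends distinct components of [x] to distinct degrees, so
that [a * x = 0] forces [a] to kill every component. *)
Lemma exists_identity_projection : exists p : 'End(A), [/\ forall x, p x \in gr 1%g, p 1 = 1
  & forall h a x, a \in gr h -> a * x = 0 -> a * p x = 0].
Proof.
have [s [p [us ps sumE]]] := homog_proj.
exists (if 1%g \in s then p 1%g else 0); split=> [x||h a x ha].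
- by case: ifP => _; rewrite ?zero_lfunE ?mem0v.
- have pg1 g : p g 1 \in gr g by [].
  have := direct_sum_homog (homog_direct gr) (fun g => mem0v (gr g))
    (fun g x y => @memvB _ _ (gr g) x y) us pg1 (h := 1%g).
  rewrite -sumE homog1 => /(_ isT) {2}->.
  by case: ifP => _; rewrite ?zero_lfunE.
case: ifP => [s1|_]; last by rewrite zero_lfunE mulr0.
rewrite {1}[x]sumE mulr_sumr => sum0.
(* The component of [a * x] of degree [g] is [a] times that of [x] of degree
   [h^-1 * g]. *)
have := (homog_direct gr).2 [seq (h * g)%g | g <- s] (fun g => a * p (h^-1 * g)%g x).
rewrite map_inj_uniq ?big_map; last exact: mulgI.
rewrite (eq_bigr (fun g => a * p g x)) => [|g _]; last by rewrite mulKg.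
move=> /(_ us) H; have {}H := H _ sum0 _ (map_f _ s1).
rewrite mulKg in H; apply: H => g.
by rewrite -{2}[g](mulVKg h); apply: homogM.
Qed.

(** The inverse respects degrees automatically: if [f' y] had a component of
another degree than [y], its image would be a component of [y] of that degree. *)
Lemma graded_iso_bij (M N : gradedModule gr) (f : {linear M -> N}) f' :
  graded_hom f -> cancel f f' -> cancel f' f -> graded_iso M N.
Proof.
move=> hf fK f'K.
pose f'L : {linear N -> M} := HB.pack f' (GRing.isLinear.Build A N M *:%R f'
  (can2_linear fK f'K)).
exists f, f'L; split=> // g y gy; rewrite /f'L /=.
have [s [d [us hd yE]]] := (gcomp_direct M).1 (f' y).
have fd h : gcomp h (f (d h)) by apply: hf.
have sumE : \sum_(h <- s) f (d h) = y by rewrite -linear_sum -yE f'K.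
have := direct_sum_homog (gcomp_direct N) (gcomp0 N)
  (fun g x y => @gcompB _ _ _ _ N g x y) us fd (h := g).
rewrite sumE => /(_ gy) ->; case: ifP => _; first by rewrite fK.
by rewrite -(linear0 f) fK; apply: gcomp0.
Qed.

(** The annihilator of a homogeneous element is a graded left ideal: the elements
[d g *: m] have the distinct degrees [g * tau], so they vanish if their sum
does. *)
Lemma homog_component_annihilator (M : gradedModule gr) (tau : G) (m : M) (a : A) :
  gcomp tau m -> a *: m = 0 ->
  exists (s : seq G) (d : G -> A),
    [/\ a = \sum_(g <- s) d g, forall g, d g \in gr g
      & forall g, g \in s -> d g *: m = 0].
Proof.
move=> tm am; have [s [d [us hd aE]]] := (homog_direct gr).1 a.
exists s, d; split=> // g gs.
apply: ((suspension_comp_direct M tau).2 s (fun g => d g *: m)) gs => //.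
  by move=> h; apply: gcompZ.
by rewrite -scaler_suml -aE.
Qed.

End Graded.

Theorem theorem4p6 (G : groupType) (k : fieldType) (A : falgType k)
    (gr : grading G A) :
  frobenius A ->
  local_ring (subvs_of (identity_component gr)) ->
  exists sigma : G, graded_frobenius gr sigma.
Proof.
move=> [f [psi fK psiK]] locAe.
have psiL : linear psi := can2_linear fK psiK.
pose psiA : {linear dual A -> A^o} :=
  HB.pack psi (GRing.isLinear.Build A (dual A) A^o *:%R psi psiL).
have [s [d [us hd lamE]]] := (gcomp_direct (graded_dual gr)).1 (f 1).
have [p [pe p1 pann]] := exists_identity_projection gr.
pose v g : A := psiA (d g).
have dE g (a : A) : a *: d g = f (a * v g).
  by transitivity (a *: f (v g)); rewrite ?psiK -?linearZ.
have sumv : \sum_(g <- s) v g = 1 by rewrite -linear_sum -lamE; apply: fK.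
have [|tau taus Uu] := local_sum1_unit (s := s)
    (u := fun g => vsproj (identity_component gr) (p (v g))) locAe.
  apply: val_inj; rewrite -linear_sum /= -linear_sum sumv /= p1 vsprojK ?homog1 //.
  exact/esym/algid_identity_component.
have regu b : b * p (v tau) = 0 -> b = 0.
  have /(congr1 val) /= := mulrV Uu; rewrite vsprojK //.
  rewrite (algid_identity_component gr : algid _ = 1) => uw bu.
  by rewrite -[b]mulr1 -uw mulrA bu mul0r.
have Uv : v tau \is a GRing.unit.
  apply: unitr_rreg => a av.
  have atau : a *: (d tau : graded_dual gr) = 0.
    by rewrite dE av; apply: (linear0 f).
  have [t [c [-> hc ct]]] := homog_component_annihilator (hd tau) atau.
  rewrite big1_seq // => h /andP[_ ht]; apply: regu; apply: (pann h) => //.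
  have : psiA (c h *: d tau) = 0 by rewrite ct ?linear0.
  by rewrite linearZ.
exists tau^-1%g.
pose F (a : A^o) : dual A := a *: d tau.
have FL : linear F.
  by move=> a x y; rewrite /F scalerDl scalerA.
pose FA : {linear suspension (graded_regular gr) tau^-1%g -> graded_dual gr} :=
  HB.pack F (GRing.isLinear.Build A A^o (dual A) *:%R F FL).
have FE a : F a = f (a * v tau) by exact: dE.
apply: (@graded_iso_bij _ _ _ _ _ _ FA (fun x => psi x * (v tau)^-1)).
- move=> g a ga; rewrite -[g](mulgVK tau); exact: gcompZ ga (hd tau).
- by move=> a; rewrite /= FE fK mulrK.
by move=> x; rewrite /= FE mulrVK ?psiK.
Qed.
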